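(* Let $G=(V,D,B)$ be a mixed graph with $V=[m]$ (directed cycles allowed), and let $$\phi_G:\mathbb{R}^D_{\mathrm{reg}}\times \mathit{PD}(B)\to \mathit{PD}(m),\qquad \phi_G(\Lambda,\Omega)=(I-\Lambda)^{-T}\,\Omega\,(I-\Lambda)^{-1}.$$ If $\phi_G$ is injective, then $G$ is acyclic, i.e., the directed graph $(V,D)$ contains no directed cycle.
   Context: A mixed graph is a triple $G=(V,D,B)$ with $V$ a finite node set, here $V=[m]:=\{1,\dots,m\}$, and $D,B\subseteq V\times V$. Elements $(i,j)\in D$ are directed edges $i\to j$ (both $i\to j$ and $j\to i$ may be present). $B$ is symmetric, $(i,j)\in B$ iff $(j,i)\in B$, and its elements are bidirected edges $i\leftrightarrow j$. There are no self-loops: $(i,i)\notin D\cup B$ for all $i$. $\mathbb{R}^D$ is the set of real $m\times m$ matrices $\Lambda=(\lambda_{ij})$ with $\lambda_{ij}=0$ whenever $(i,j)\notin D$; $\mathbb{R}^D_{\mathrm{reg}}$ is the subset of $\Lambda\in\mathbb{R}^D$ with $I-\Lambda$ invertible. $\mathit{PD}(m)$ is the cone of real symmetric positive definite $m\times m$ matrices; $\mathit{PD}(B)$ is the set of $\Omega=(\omega_{ij})\in \mathit{PD}(m)$ with $\omega_{ij}=0$ whenever $i\neq j$ and $(i,j)\notin B$. $M^{-T}$ denotes the transpose of $M^{-1}$. *)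

(* Defs.v *)
From HB Require Import structures.
From mathcomp Require Import all_boot all_order all_algebra.
From mathcomp Require Import all_classical reals.

Set Implicit Arguments.
Unset Strict Implicit.
Unset Printing Implicit Defensive.

Import Order.TTheory GRing.Theory Num.Theory.

Local Open Scope classical_set_scope.
Local Open Scope ring_scope.

(* The node set [m] = {1, ..., m} is rendered as 'I_m = {0, ..., m - 1}. *)
Record mixed_graph (m : nat) := MixedGraph {
  directed : {set 'I_m * 'I_m};
  bidirected : {set 'I_m * 'I_m};
  bidirected_sym : forall i j,
    ((i, j) \in bidirected) = ((j, i) \in bidirected);
  directed_irr : forall i, (i, i) \notin directed;
  bidirected_irr : forall i, (i, i) \notin bidirected
}.

Definition dedge (m : nat) (G : mixed_graph m) : rel 'I_m :=
  fun i j => (i, j) \in directed G.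

(* [cycle e [:: i_1; ...; i_k]] means e i_1 i_2, ..., e i_(k-1) i_k, e i_k i_1;
   it holds for the empty sequence, which is therefore excluded. *)
Definition directed_cycle (m : nat) (G : mixed_graph m) (p : seq 'I_m) : Prop :=
  p <> [::] /\ cycle (dedge G) p.

Definition acyclic (m : nat) (G : mixed_graph m) : Prop :=
  ~ exists p : seq 'I_m, directed_cycle G p.

Definition RD (R : realType) (m : nat) (G : mixed_graph m) : set 'M[R]_m :=
  [set L | forall i j, (i, j) \notin directed G -> L i j = 0].

Definition RDreg (R : realType) (m : nat) (G : mixed_graph m) : set 'M[R]_m :=
  [set L | RD G L /\ 1%:M - L \in unitmx].

Definition PD (R : realType) (m : nat) : set 'M[R]_m :=
  [set M | M^T = M /\
    forall x : 'cV[R]_m, x != 0 -> 0 < (x^T *m M *m x) ord0 ord0].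

Definition PDB (R : realType) (m : nat) (G : mixed_graph m) : set 'M[R]_m :=
  [set W | PD W /\
    forall i j, i != j -> (i, j) \notin bidirected G -> W i j = 0].

Definition phi_dom (R : realType) (m : nat) (G : mixed_graph m) :
  set ('M[R]_m * 'M[R]_m) := RDreg G `*` PDB G.

(* The formula does not mention G, which enters only through [phi_dom]. *)
Definition phi (R : realType) (m : nat) (LW : 'M[R]_m * 'M[R]_m) : 'M[R]_m :=
  (invmx (1%:M - LW.1))^T *m LW.2 *m invmx (1%:M - LW.1).

Lemma phi_PD (R : realType) (m : nat) (G : mixed_graph m) :
  set_fun (phi_dom G) (@PD R m) (@phi R m).
Proof.
move=> [L W] [] /= [_ Lreg] [[Wsym Wpos] _]; split => /=.
  by rewrite /phi /= !trmx_mul trmxK Wsym mulmxA.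
move=> x x0; rewrite /phi /=; set N := invmx _.
have -> : x^T *m (N^T *m W *m N) *m x = (N *m x)^T *m W *m (N *m x).
  by rewrite trmx_mul !mulmxA.
apply: Wpos; apply: contra_neq x0 => Nx0.
by rewrite -[x](mulKVmx Lreg) -/N Nx0 mulmx0.
Qed.

(* Main.v *)
Require Import Defs.
From mathcomp Require Import all_boot all_order all_algebra.
From mathcomp Require Import all_classical reals.
From mathcomp Require Import ring lra.

(** For a simple directed cycle, let N be the 0/1 matrix of its edges; then
    N N^T is the diagonal projection onto the nodes of the cycle.  With
    Lambda_a = a N and Omega_a = I + a^2 N N^T, where a^2 <> 1,
      (I - Lambda_a) Omega_a^-1 (I - Lambda_a)^T = I - a / (1 + a^2) (N + N^T),
    and a / (1 + a^2) is invariant under a -> 1 / a.  Hence a = 2 and a = 1 / 2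
    parametrize the same covariance matrix. *)

Set Implicit Arguments.
Unset Strict Implicit.
Unset Printing Implicit Defensive.

Import GRing.Theory Num.Theory Order.TTheory.
Local Open Scope ring_scope.

(** Open the cycle at its head [x] and shorten the resulting path: both endpoints are kept, so the
    edge from the last node back to [x] still closes it. *)
Lemma uniq_subcycle (T : eqType) (e : rel T) (p : seq T) :
  p <> [::] -> cycle e p -> exists2 q, q <> [::] & uniq q && cycle e q.
Proof.
case: p => [//|x p] _; rewrite (cycle_path x) /= => /andP[+ e_p].
case/shortenP: e_p => q e_q uniq_q _ e_last.
by exists (x :: q) => //; rewrite uniq_q (cycle_path x) /= e_last e_q.
Qed.

Section PartialIsometry.
Context {R : realType} {m : nat}.
Implicit Types (N L W V : 'M[R]_m) (a : R).

Lemma row_sqr_ge0 (u : 'rV[R]_m) : 0 <= (u *m u^T) ord0 ord0.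
Proof. by rewrite mxE sumr_ge0 // => i _; rewrite mxE -expr2 sqr_ge0. Qed.

Lemma row_sqr_eq0 (u : 'rV[R]_m) : (u *m u^T) ord0 ord0 = 0 -> u = 0.
Proof.
rewrite mxE => /eqP; rewrite psumr_eq0 => [/allP u0|i _]; last first.
  by rewrite mxE -expr2 sqr_ge0.
apply/rowP => i; have := u0 i (mem_index_enum i).
by rewrite !mxE -expr2 sqrf_eq0 => /eqP.
Qed.

(** A row [u] in the left kernel satisfies u = a u N, hence u N N^T = u, hence |u|^2 = a^2 |u|^2,
    which forces u = 0. *)
Lemma unitmx_1BZ_partial_isometry N a :
  N *m (N *m N^T) = N -> a ^+ 2 != 1 -> 1%:M - a *: N \in unitmx.
Proof.
move=> NNN a1; rewrite -row_free_unit; apply: inj_row_free => u /eqP.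
rewrite mulmxBr mulmx1 -scalemxAr subr_eq0 => /eqP uE.
have uD : u *m (N *m N^T) = u by rewrite {1}uE -scalemxAl -mulmxA NNN -uE.
have uuE : u *m u^T = a ^+ 2 *: (u *m u^T).
  rewrite {1 2}uE linearZ /= trmx_mul -scalemxAl -scalemxAr scalerA -expr2.
  by rewrite -{3}uD !mulmxA.
apply: row_sqr_eq0; move/matrixP/(_ ord0 ord0)/eqP: uuE.
rewrite [X in _ == X]mxE -subr_eq0 -{1}[X in X - _]mul1r -mulrBl mulf_eq0.
by rewrite subr_eq0 eq_sym (negPf a1) => /eqP.
Qed.

Lemma PD_1DZ_gram N a : PD (1%:M + a ^+ 2 *: (N *m N^T)).
Proof.
split; first by rewrite linearD linearZ /= trmx1 trmx_mul trmxK.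
move=> x x0; rewrite mulmxDr mulmx1 mulmxDl -scalemxAr -scalemxAl.
rewrite mxE [X in _ + X]mxE ltr_wpDr //.
  rewrite mulr_ge0 ?sqr_ge0 //.
  by have := row_sqr_ge0 (x^T *m N); rewrite trmx_mul trmxK !mulmxA.
have := row_sqr_ge0 x^T; rewrite trmxK lt_def => ->; rewrite andbT.
apply: contra_neq x0 => xx0; apply: trmx_inj; rewrite trmx0.
by apply: row_sqr_eq0; rewrite trmxK.
Qed.

(** Passing to the inverse covariance turns [phi] into a polynomial in [L] and [V]; taking [V] as a
    parameter lets an explicit inverse of [W] be supplied. *)
Lemma phi_invmx L W V :
  1%:M - L \in unitmx -> V *m W = 1%:M ->
  phi (L, W) = invmx ((1%:M - L) *m V *m (1%:M - L)^T).
Proof.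
move=> Lu VW; rewrite /phi /=; set A := 1%:M - L.
have AT : A^T *m (invmx A)^T = 1%:M by rewrite -trmx_mul mulVmx ?trmx1.
set K := A *m V *m A^T; set S := _ *m invmx A.
have KS : K *m S = 1%:M.
  rewrite /K /S -!mulmxA (mulmxA A^T) AT mul1mx (mulmxA V) VW mul1mx.
  exact: mulmxV.
have [Ku _] := mulmx1_unit KS.
by rewrite -[S](mulKmx Ku) KS mulmx1.
Qed.

Lemma phi_partial_isometry N a :
  N *m (N *m N^T) = N -> N *m N^T *m N = N -> a ^+ 2 != 1 ->
  phi (a *: N, 1%:M + a ^+ 2 *: (N *m N^T)) =
  invmx (1%:M - (a / (1 + a ^+ 2)) *: (N + N^T)).
Proof.
(* As D = N N^T is idempotent, I + a^2 D has inverse I - b D. In the expanded product the D terms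
   cancel because a^2 (1 - b) = b, and N keeps the coefficient -a (1 - b) = -a / (1 + a^2). *)
move=> NNN NNtN a1; set b := a ^+ 2 / (1 + a ^+ 2).
have d0 : 1 + a ^+ 2 != 0 by rewrite lt0r_neq0 // ltr_wpDr ?sqr_ge0.
have NNNt : N *m N^T *m N^T = N^T.
  by have := congr1 trmx NNN; rewrite !trmx_mul trmxK.
have DD : N *m N^T *m (N *m N^T) = N *m N^T by rewrite mulmxA NNtN.
rewrite (@phi_invmx _ _ (1%:M - b *: (N *m N^T))) ?unitmx_1BZ_partial_isometry //.
  have -> : (1%:M - a *: N)^T = 1%:M - a *: N^T.
    by rewrite linearB /= trmx1 [(a *: N)^T]linearZ.
  congr invmx.
  rewrite !(mulmxBl, mulmxBr, mulmx1, mul1mx) -!(scalemxAl, scalemxAr).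
  rewrite NNN NNNt; apply/matrixP => i j.
  (* Generalizing the product keeps [mxE] from unfolding it into a sum, so the goal is a scalar
     identity. *)
  move: (N *m N^T) => D; rewrite !mxE /b; field.
  exact: d0.
rewrite !(mulmxBl, mulmxDr, mulmx1, mul1mx) -!(scalemxAl, scalemxAr) DD.
apply/matrixP => i j; move: (N *m N^T) => D; rewrite !mxE /b; field.
exact: d0.
Qed.

End PartialIsometry.

Section CycleMatrix.
Context {R : realType} {m : nat} (p : seq 'I_m).

(** [next p] fixes every node outside [p]; the guard [i \in p] makes those rows zero instead of
    putting ones on the diagonal. *)
Definition cycle_mx : 'M[R]_m :=
  \matrix_(i, j) ((i \in p) && (j == next p i))%:R.

Hypothesis uniq_p : uniq p.

(** [next p] is injective, with inverse [prev p], so the nonzero rows are distinct unit vectors. *)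
Lemma cycle_mx_mul_trE i j :
  (cycle_mx *m cycle_mx^T) i j = ((i \in p) && (i == j))%:R.
Proof.
rewrite mxE (bigD1 (next p i)) //= big1 => [|k /negPf kni]; last first.
  by rewrite !mxE kni andbF mul0r.
rewrite addr0 !mxE eqxx andbT -natrM mulnb.
rewrite (inj_eq (can_inj (prev_next uniq_p))).
by case: eqP => [->|]; rewrite ?andbF // andbT andbb.
Qed.

(** [next p] maps [p] into itself, so nonzero columns also have their index in [p]. *)
Lemma mul_cycle_mx_proj : cycle_mx *m (cycle_mx *m cycle_mx^T) = cycle_mx.
Proof.
apply/matrixP => i j; rewrite mxE (bigD1 j) //= big1 => [|k /negPf kj].
  rewrite cycle_mx_mul_trE !mxE eqxx andbT addr0 -natrM mulnb.
  by case: eqP => [->|]; rewrite ?andbF // mem_next andbT andbb.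
by rewrite cycle_mx_mul_trE kj andbF mulr0.
Qed.

Lemma mul_proj_cycle_mx : cycle_mx *m cycle_mx^T *m cycle_mx = cycle_mx.
Proof.
apply/matrixP => i j; rewrite mxE (bigD1 i) //= big1 => [|k ki].
  by rewrite cycle_mx_mul_trE !mxE eqxx andbT addr0 -natrM mulnb andbA andbb.
by rewrite cycle_mx_mul_trE eq_sym (negPf ki) andbF mul0r.
Qed.

Lemma cycle_mx_phi_dom (G : mixed_graph m) (a : R) :
  cycle (dedge G) p -> a ^+ 2 != 1 ->
  phi_dom G (a *: cycle_mx, 1%:M + a ^+ 2 *: (cycle_mx *m cycle_mx^T)).
Proof.
move=> cyc_p a1; split; split => /=.
- move=> i j; rewrite !mxE.
  have [ip /=|] := boolP (i \in p); last by rewrite mulr0.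
  case: eqP => [->|]; last by rewrite mulr0.
  by have := next_cycle cyc_p ip; rewrite /dedge => ->.
- exact: unitmx_1BZ_partial_isometry mul_cycle_mx_proj a1.
- exact: PD_1DZ_gram.
(* Omega is diagonal, so it fits the zero pattern of every [bidirected G]. *)
- move=> i j /negPf ij _; rewrite mxE [X in _ + X]mxE cycle_mx_mul_trE mxE.
  by rewrite ij andbF mulr0 addr0.
Qed.

End CycleMatrix.

Theorem theorem1 (R : realType) (m : nat) (G : mixed_graph m) :
  set_inj (phi_dom G) (@phi R m) -> acyclic G.
Proof.
move=> phi_inj [p0 [p0N0 cyc_p0]].
have [[//|x p] _ /andP[uniq_p cyc_p]] := uniq_subcycle p0N0 cyc_p0.
have a1 : 2 ^+ 2 != 1 :> R by apply/eqP; lra.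
have b1 : 2^-1 ^+ 2 != 1 :> R by apply/eqP; lra.
have dom2 := @cycle_mx_phi_dom R m _ uniq_p G _ cyc_p a1.
have domV2 := @cycle_mx_phi_dom R m _ uniq_p G _ cyc_p b1.
have /= := phi_inj _ _ (mem_set dom2) (mem_set domV2).
rewrite !phi_partial_isometry ?mul_cycle_mx_proj ?mul_proj_cycle_mx //.
have -> : 2^-1 / (1 + 2^-1 ^+ 2) = 2 / (1 + 2 ^+ 2) :> R by field.
(* Equality of the Lambda components, read at the cycle edge leaving [x], where N has entry 1, says
   2 = 1 / 2. *)
move=> /(_ erefl) [] /matrixP/(_ x (next (x :: p) x)) + _.
rewrite !mxE mem_head eqxx !mulr1; lra.
Qed.
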